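(* Let $0$ and $I$ denote the $2 \times 2$ zero matrix and the $2 \times 2$ identity matrix, respectively, and let $[0,I]=\{X\in S_2 : 0\le X\le I\}$ be the matrix interval in $S_2$, the set of all $2\times 2$ real symmetric matrices. Then a map $\phi : [0, I] \to [0, I]$ is an order automorphism if and only if there exists an invertible $2\times 2$ real matrix $T$ such that $$ \phi (X) = T \left( X (T^t T -I) +I \right)^{-1} X T^t $$ for every $X \in [0,I]$.
   Context: For real symmetric matrices $A,B$ of the same size, $A\le B$ means that $B-A$ is positive semidefinite (Loewner order). $T^t$ is the transpose of $T$. An order automorphism of $[0,I]$ is a bijective map $\phi:[0,I]\to[0,I]$ such that for all $X,Y\in[0,I]$: $X\le Y\iff\phi(X)\le\phi(Y)$. *)

(* Defs.v *)
From mathcomp Require Import all_boot all_order all_algebra.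
From mathcomp Require Import all_classical reals.

Set Implicit Arguments.
Unset Strict Implicit.
Unset Printing Implicit Defensive.

Import Order.TTheory GRing.Theory Num.Theory.
Local Open Scope classical_set_scope.
Local Open Scope ring_scope.

Definition psdmx (R : realType) (n : nat) (A : 'M[R]_n) : Prop :=
  A \is symmetricmx /\ forall x : 'cV[R]_n, 0 <= (x^T *m A *m x) 0 0.

Definition loewner_le (R : realType) (n : nat) (A B : 'M[R]_n) : Prop :=
  psdmx (B - A).

(* Used as a type through the coercion [set_type]: elements are the symmetric
   matrices of the interval, with [val] the underlying matrix. *)
Definition mx_interval (R : realType) (n : nat) (A B : 'M[R]_n) : set 'M[R]_n :=
  [set X | [/\ X \is symmetricmx, loewner_le A X & loewner_le X B]].

Definition order_automorphism (R : realType) (n : nat) (A B : 'M[R]_n)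
    (phi : mx_interval A B -> mx_interval A B) : Prop :=
  bijective phi /\
  forall X Y : mx_interval A B,
    loewner_le (val X) (val Y) <-> loewner_le (val (phi X)) (val (phi Y)).

(* Main.v *)
(* On invertible X the formula reads phi(X)^-1 - 1 = S (X^-1 - 1) S^t with
   S = (T^t)^-1, so the point is to show that an order automorphism phi acts on
   r = X^-1 - 1, which ranges over the positive semidefinite cone, by a
   congruence r |-> K r.

   The singular effects are the multiples t vv^t of rank one projections, and phi
   preserves them because they are the effects whose lower effects form a chain.
   As t vv^t <= X iff t <v, X^-1 v> <= 1, each direction v has an image direction
   w such that <w, K r w> is an increasing function g of <v, r v>. Binary
   quadratic forms vanishing in three directions vanish, so choosing four forms
   that agree pairwise in three directions gives Jensen's equation for g; hence g
   is linear and, after rescaling w, <w, K r w> = <v, r v>. Three directions v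
   then determine K as a congruence.

   Singular effects are recovered from their invertible upper bounds. *)

Require Import Defs.
From mathcomp Require Import all_boot all_order all_algebra.
From mathcomp Require Import all_classical reals.
From mathcomp Require Import ring lra.

Set Implicit Arguments.
Unset Strict Implicit.
Unset Printing Implicit Defensive.

Import Order.TTheory GRing.Theory Num.Theory.
Local Open Scope ring_scope.

Local Notation "A <=L B" := (loewner_le A B) (at level 70, no associativity).

(** * Euclidean product and Loewner order *)

Section Dot.
Context {R : realType} {n : nat}.
Implicit Types (x y z : 'cV[R]_n) (A B : 'M[R]_n) (a : R).

Definition dot x y : R := (x^T *m y) 0 0.

Lemma dotE x y : dot x y = \sum_i x i 0 * y i 0.
Proof. by rewrite /dot mxE; apply: eq_bigr => i _; rewrite mxE. Qed.

Lemma dotC x y : dot x y = dot y x.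
Proof. by rewrite !dotE; apply: eq_bigr => i _; rewrite mulrC. Qed.

Lemma dotDr x y z : dot x (y + z) = dot x y + dot x z.
Proof. by rewrite /dot mulmxDr mxE. Qed.

Lemma dotZr a x y : dot x (a *: y) = a * dot x y.
Proof. by rewrite /dot -scalemxAr mxE. Qed.

Lemma dotNr x y : dot x (- y) = - dot x y.
Proof. by rewrite -scaleN1r dotZr mulN1r. Qed.

Lemma dot0r x : dot x 0 = 0.
Proof. by rewrite /dot mulmx0 mxE. Qed.

Lemma dotDl x y z : dot (x + y) z = dot x z + dot y z.
Proof. by rewrite dotC dotDr !(dotC z). Qed.

Lemma dotZl a x y : dot (a *: x) y = a * dot x y.
Proof. by rewrite dotC dotZr dotC. Qed.

Lemma dotNl x y : dot (- x) y = - dot x y.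
Proof. by rewrite dotC dotNr dotC. Qed.

Lemma dot0l x : dot 0 x = 0.
Proof. by rewrite dotC dot0r. Qed.

Lemma dot_mul A x y : dot x (A *m y) = dot (A^T *m x) y.
Proof. by rewrite /dot trmx_mul trmxK mulmxA. Qed.

Lemma dot_ge0 x : 0 <= dot x x.
Proof. by rewrite dotE; apply: sumr_ge0 => i _; rewrite -expr2 sqr_ge0. Qed.

Lemma dot_eq0 x : (dot x x == 0) = (x == 0).
Proof.
apply/eqP/eqP => [|->]; last by rewrite dot0r.
rewrite dotE => /eqP; rewrite psumr_eq0 => [/allP h|i _]; last first.
  by rewrite -expr2 sqr_ge0.
apply/matrixP => i j; rewrite ord1 mxE; apply/eqP.
by have := h i (mem_index_enum i); rewrite mulf_eq0 orbb.
Qed.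

Lemma dot_gt0 x : x != 0 -> 0 < dot x x.
Proof. by rewrite lt0r dot_eq0 dot_ge0 andbT. Qed.

Lemma symmxP A : reflect (A^T = A) (A \is symmetricmx).
Proof.
apply: (iffP eqP) => [hA|hA]; last by rewrite expr0 scale1r map_mx_id.
by rewrite [RHS]hA expr0 scale1r map_mx_id.
Qed.

Lemma outerE x y z : (x *m y^T) *m z = dot y z *: x.
Proof.
by rewrite -mulmxA [y^T *m z]mx11_scalar mul_mx_scalar.
Qed.

Lemma eq_mulcV A B : (forall x, A *m x = B *m x) -> A = B.
Proof.
move=> h; apply/matrixP => i j.
by have /matrixP/(_ i 0) := h (delta_mx j 0); rewrite -!colE !mxE.
Qed.

(** At [x + A x] only the cross terms of the form survive, and they add up to twice the squared norm
    of [A x]. *)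
Lemma sym_qf0 A : A^T = A -> (forall x, dot x (A *m x) = 0) -> A = 0.
Proof.
move=> sA h; apply: eq_mulcV => x; rewrite mul0mx; apply/eqP.
rewrite -dot_eq0; apply/eqP.
have := h (x + A *m x); rewrite mulmxDr !dotDl !dotDr !h.
rewrite (dot_mul A x) sA; lra.
Qed.

End Dot.

Lemma unitmx_ker0 (F : fieldType) (n : nat) (A : 'M[F]_n) :
  (forall x : 'cV[F]_n, A *m x = 0 -> x = 0) -> A \in unitmx.
Proof.
move=> h; rewrite -unitmx_tr -row_free_unit -kermx_eq0; apply/eqP/row_matrixP => i.
rewrite row0; apply: trmx_inj; rewrite trmx0; apply: h.
by apply: trmx_inj; rewrite trmx_mul trmxK -row_mul mulmx_ker row0 trmx0.
Qed.

Section Loewner.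
Context {R : realType} {n : nat}.
Implicit Types (x y z : 'cV[R]_n) (A B C X Y : 'M[R]_n) (a : R).

Lemma psdP A : psdmx A <-> A^T = A /\ forall x, 0 <= dot x (A *m x).
Proof.
split=> -[sA hA]; split; try exact/symmxP.
  by move=> x; rewrite /dot mulmxA; exact: hA.
by move=> x; rewrite -mulmxA; exact: hA.
Qed.

Lemma psd_sym A : psdmx A -> A^T = A. Proof. by case/psdP. Qed.
Lemma psd_ge0 A x : psdmx A -> 0 <= dot x (A *m x). Proof. by case/psdP. Qed.

Lemma psd0 : psdmx (0 : 'M[R]_n).
Proof. by apply/psdP; split=> [|x]; rewrite ?trmx0 // mul0mx dot0r. Qed.

Lemma psd1 : psdmx (1%:M : 'M[R]_n).
Proof. by apply/psdP; split=> [|x]; rewrite ?trmx1 // mul1mx dot_ge0. Qed.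

Lemma psdD A B : psdmx A -> psdmx B -> psdmx (A + B).
Proof.
move=> pA pB; apply/psdP; split=> [|x]; first by rewrite linearD /= !psd_sym.
by rewrite mulmxDl dotDr addr_ge0 ?psd_ge0.
Qed.

Lemma psdZ a A : 0 <= a -> psdmx A -> psdmx (a *: A).
Proof.
move=> a0 pA; apply/psdP; split=> [|x]; first by rewrite linearZ /= psd_sym.
by rewrite -scalemxAl dotZr mulr_ge0 ?psd_ge0.
Qed.

Lemma psd_congr A C : psdmx A -> psdmx (C *m A *m C^T).
Proof.
move=> pA; apply/psdP; split=> [|x].
  by rewrite !trmx_mul trmxK (psd_sym pA) mulmxA.
by rewrite -!mulmxA dot_mul psd_ge0.
Qed.

Lemma psd_outer x : psdmx (x *m x^T).
Proof.
apply/psdP; split=> [|y]; first by rewrite trmx_mul trmxK.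
by rewrite outerE dotZr dotC -expr2 sqr_ge0.
Qed.

(** Discriminant argument: the form at [r x - p y] equals [r (q r - p^2)]. If [r = 0], a nonzero [p]
    would let the form take negative values. *)
Lemma psd_cauchy A x y : psdmx A ->
  dot x (A *m y) ^+ 2 <= dot x (A *m x) * dot y (A *m y).
Proof.
move=> pA; have sA := psd_sym pA.
set p := dot x _; set q := dot x _; set r := dot y _.
have r0 : 0 <= r by exact: psd_ge0.
have q0 : 0 <= q by exact: psd_ge0.
have h s t : 0 <= s ^+ 2 * q + 2 * (s * t) * p + t ^+ 2 * r.
  have := psd_ge0 (s *: x + t *: y) pA.
  rewrite mulmxDr -!scalemxAr !(dotDl, dotDr, dotZl, dotZr).
  rewrite (dot_mul A y x) sA (dotC (A *m y)) -/p -/q -/r => /le_trans; apply.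
  by rewrite le_eqVlt; apply/orP; left; apply/eqP; ring.
have [r00|r00] := eqVneq r 0.
  have [->|p0] := eqVneq p 0; first by rewrite r00 mulr0 expr0n.
  have := h 1 (- ((q + 1) / p)); rewrite r00 !mulr0 addr0 expr1n !mul1r.
  by rewrite mulrN mulNr -mulrA divfK //; lra.
have := h r (- p).
have -> : r ^+ 2 * q + 2 * (r * - p) * p + (- p) ^+ 2 * r = r * (q * r - p ^+ 2).
  by ring.
by rewrite pmulr_rge0 ?subr_ge0 // lt_neqAle eq_sym r00.
Qed.

Lemma psd_ker A x : psdmx A -> dot x (A *m x) = 0 -> A *m x = 0.
Proof.
move=> pA h; apply/eqP; rewrite -dot_eq0.
have := psd_cauchy (A *m x) x pA; rewrite h mulr0 exprn_even_le0 //=.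
Qed.

Lemma psd_unitP A : psdmx A ->
  reflect (forall x, x != 0 -> 0 < dot x (A *m x)) (A \in unitmx).
Proof.
move=> pA; apply: (iffP idP) => [uA x x0|h].
  rewrite lt_neqAle psd_ge0 // andbT eq_sym; apply: contra x0 => /eqP /(psd_ker pA) h.
  by rewrite -(mulKmx uA x) h mulmx0.
apply: unitmx_ker0 => x Ax; apply/eqP; apply: contraT => /h.
by rewrite Ax dot0r ltxx.
Qed.

Lemma le_dot A B x : A <=L B -> dot x (A *m x) <= dot x (B *m x).
Proof. by move=> /(psd_ge0 x); rewrite mulmxBl dotDr dotNr subr_ge0. Qed.

Lemma leLP A B : A^T = A -> B^T = B ->
  (A <=L B) <-> forall x, dot x (A *m x) <= dot x (B *m x).
Proof.
move=> sA sB; split=> [h x|h]; first exact: le_dot.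
apply/psdP; split=> [|x]; first by rewrite linearB /= sA sB.
by rewrite mulmxBl dotDr dotNr subr_ge0.
Qed.

Lemma leL_refl A : A <=L A.
Proof. by rewrite /loewner_le subrr; exact: psd0. Qed.

Lemma leL_trans B A C : A <=L B -> B <=L C -> A <=L C.
Proof. by move=> h k; have := psdD k h; rewrite addrA subrK. Qed.

Lemma leL_anti A B : A <=L B -> B <=L A -> A = B.
Proof.
move=> h k; apply/eqP; rewrite -subr_eq0; apply/eqP; apply: sym_qf0.
  exact: psd_sym.
move=> x; have := le_dot x h; have := le_dot x k.
by rewrite mulmxBl dotDr dotNr; lra.
Qed.

Definition effect A := psdmx A /\ (A <=L 1%:M).

Lemma effect_sym A : effect A -> A^T = A. Proof. by case=> /psd_sym. Qed.

Lemma effectP A : mx_interval 0 1%:M A <-> effect A.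
Proof.
rewrite /mx_interval /= /loewner_le subr0; split=> [[]|[pA h]] //.
by split=> //; case: pA.
Qed.

Lemma effect0 : effect 0.
Proof. by split; [exact: psd0|rewrite /loewner_le subr0; exact: psd1]. Qed.

Lemma effect1 : effect 1%:M.
Proof. by split; [exact: psd1|exact: leL_refl]. Qed.

(** With [e = A x - B y], add the nonnegative values of A at [e - x] and of B at [e + y], then bound
    [<e, (A + B) e>] by [<e, e>]. *)
Lemma sum_le1_sq A B x y : psdmx A -> psdmx B -> A + B <=L 1%:M ->
  dot (A *m x - B *m y) (A *m x - B *m y) <= dot x (A *m x) + dot y (B *m y).
Proof.
move=> pA pB h; move eE : (A *m x - B *m y) => e.
have := psd_ge0 (e - x) pA; have := psd_ge0 (e + y) pB; have := le_dot e h.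
rewrite mul1mx !(mulmxDl, mulmxDr, mulmxN, dotDl, dotDr, dotNl, dotNr).
rewrite (dot_mul A x e) (dot_mul B y e) (psd_sym pA) (psd_sym pB).
rewrite (dotC (A *m x) e) (dotC (B *m y) e).
have -> : dot e e = dot e (A *m x) - dot e (B *m y).
  by rewrite -[X in dot e X]eE dotDr dotNr.
lra.
Qed.

Lemma effect_sq A x : effect A -> dot (A *m x) (A *m x) <= dot x (A *m x).
Proof.
move=> [pA h]; have := sum_le1_sq x 0 pA psd0.
by rewrite addr0 mul0mx dot0r subr0 addr0; apply.
Qed.

(** The invertible effects [A + e (1 - A)] lie above A and tend to A as e tends to 0. *)
Lemma leL_approx A B : effect A -> effect B ->
  (forall C, effect C -> C \in unitmx -> A <=L C -> B <=L C) -> B <=L A.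
Proof.
move=> eA eB h; apply/leLP => [||x]; rewrite ?effect_sym //.
have key e : 0 < e -> e <= 1 ->
    dot x (B *m x) <= dot x (A *m x) + e * (dot x x - dot x (A *m x)).
  move=> e0 e1; have p1A : psdmx (1%:M - A) by case: eA.
  pose C := A + e *: (1%:M - A).
  have CE y : dot y (C *m y) = dot y (A *m y) + e * (dot y y - dot y (A *m y)).
    by rewrite mulmxDl -scalemxAl mulmxBl mul1mx dotDr dotZr dotDr dotNr.
  have pC : psdmx C by apply: psdD; [case: eA|apply: psdZ => //; exact: ltW].
  rewrite -CE; apply: le_dot; apply: h.
  - split=> //; apply/leLP => [||y]; rewrite ?trmx1 ?psd_sym //.
    by rewrite CE mul1mx; have := le_dot y (proj2 eA); rewrite mul1mx; nra.
  - apply/psd_unitP => // y /dot_gt0 y0; rewrite CE.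
    by have := psd_ge0 y (proj1 eA); nra.
  - by rewrite /loewner_le /C addrC addKr; apply: psdZ => //; exact: ltW.
rewrite leNgt; apply/negP => lt.
set b := dot x (B *m x) in key lt; set a := dot x (A *m x) in key lt.
have a1 : a <= dot x x by have := le_dot x (proj2 eA); rewrite mul1mx.
(* If [b > a], this e lies in ]0, 1] and [e (<x, x> - a) < b - a], contradicting [key]. *)
have := key ((b - a) / (b - a + (dot x x - a) + (dot x x - a))) .
set d := b - a + _ + _; have d0 : 0 < d by rewrite /d; lra.
rewrite divr_gt0 ?subr_gt0 // ler_pdivrMr // mul1r => /(_ isT).
have -> : b - a <= d by rewrite /d; lra.
move=> /(_ isT); rewrite mulrAC -lerBlDl ler_pdivlMr // /d.
nra.
Qed.

End Loewner.

(** * The maps of the theorem are order automorphisms *)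

Section Automorphism.
Context {R : realType} {n : nat}.
Implicit Types (x y z a b e : 'cV[R]_n) (T X Y : 'M[R]_n).

Definition effect_aut T X :=
  T *m invmx (X *m (T^T *m T - 1%:M) + 1%:M) *m X *m T^T.

Lemma effect_aut_tr T X : X^T = X ->
  (X *m (T^T *m T - 1%:M) + 1%:M)^T = (T^T *m T - 1%:M) *m X + 1%:M.
Proof.
by move=> sX; rewrite linearD /= trmx_mul linearB /= trmx_mul trmxK trmx1 sX.
Qed.

Lemma dot_gram T a e : dot a ((T^T *m T - 1%:M) *m e) = dot (T *m a) (T *m e) - dot a e.
Proof. by rewrite mulmxBl mul1mx dotDr dotNr -mulmxA (dot_mul T^T) trmxK. Qed.

(** Pairing a kernel vector [a] of the transpose with [X a] gives [|T X a|^2 = |X a|^2 - <a, X a>],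
    which is at most 0 by [effect_sq]. Hence [X a = 0], and then [a = 0]. *)
Lemma effect_aut_unit T X : T \in unitmx -> effect X ->
  X *m (T^T *m T - 1%:M) + 1%:M \in unitmx.
Proof.
move=> uT eX; rewrite -unitmx_tr effect_aut_tr ?(effect_sym eX) //.
apply: unitmx_ker0 => a; rewrite (mulmxDl _ _ a) mul1mx -mulmxA => h.
have := congr1 (dot (X *m a)) h; rewrite dotDr dot_gram dot0r.
have := effect_sq a eX; rewrite (dotC a) => h1 h2.
have : dot (T *m (X *m a)) (T *m (X *m a)) == 0.
  by rewrite eq_le dot_ge0 andbT; lra.
rewrite dot_eq0 => /eqP /(congr1 (mulmx (invmx T))); rewrite mulKmx // mulmx0 => Xa.
by move: h; rewrite Xa mulmx0 add0r.
Qed.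

(* With [e = Yb - Xa], [c = a - b] and [D = Y - X], the quadratic form of the
   difference of the images at [z] is [|Te|^2 + <b,Db> + <c,Xc> - |e|^2], where
   [e = Db - Xc] and [D + X <= 1]. *)
Lemma effect_aut_homo T X Y : T \in unitmx -> effect X -> effect Y -> X <=L Y ->
  effect_aut T X <=L effect_aut T Y.
Proof.
move=> uT eX eY XY; set S := T^T *m T - 1%:M.
(* The inverse is moved across Z so that it acts on the vector: [a] solves [(S Z + 1) a = T^T z]. *)
have img Z : effect Z -> (effect_aut T Z)^T = effect_aut T Z /\
    forall z, exists2 a, S *m (Z *m a) + a = T^T *m z
      & dot z (effect_aut T Z *m z) = dot (T^T *m z) (Z *m a).
  move=> eZ; have uU := effect_aut_unit uT eZ; rewrite /effect_aut -/S.
  have tU : (Z *m S + 1%:M)^T = S *m Z + 1%:M by rewrite effect_aut_tr ?(effect_sym eZ).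
  rewrite -/S in uU; set U := Z *m S + 1%:M in uU tU *.
  have comm : invmx U *m Z = Z *m invmx U^T.
    apply: (can_inj (mulKmx uU)); rewrite mulKVmx // mulmxA.
    have -> : U *m Z = Z *m U^T.
      by rewrite tU mulmxDl mulmxDr mul1mx mulmx1 mulmxA.
    by rewrite mulmxK // unitmx_tr.
  split=> [|z].
    rewrite !trmx_mul trmxK (effect_sym eZ) trmx_inv -!mulmxA; congr (_ *m _).
    by rewrite !mulmxA comm.
  exists (invmx U^T *m (T^T *m z)).
    rewrite -[X in _ + X]mul1mx mulmxA -mulmxDl -tU mulKVmx // unitmx_tr //.
  by rewrite -(mulmxA T) comm -!mulmxA dot_mul.
have [sX hX] := img X eX; have [sY hY] := img Y eY.
apply/leLP => // z; have [a az ->] := hX z; have [b bz ->] := hY z.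
pose c := a - b; pose e := Y *m b - X *m a.
have Y1 : (Y - X) + X <=L 1%:M by rewrite subrK; case: eY.
have := sum_le1_sq b c XY (proj1 eX) Y1.
have -> : (Y - X) *m b - X *m c = e.
  by rewrite mulmxBl mulmxBr opprB addrA subrK.
(* Subtracting the equations solved by [a] and [b] gives [S e = c]. *)
have ce : dot c e = dot (T *m e) (T *m e) - dot e e.
  rewrite -dot_gram -/S dotC; congr dot; apply/eqP.
  by rewrite mulmxBr subr_eq addrAC eq_sym subr_eq bz -az addrC.
have Te := dot_ge0 (T *m e); move: ce Te.
rewrite -[in dot _ (X *m a)]bz -az !(dotDl _ _ (_ *m _)).
have -> : dot (S *m (X *m a)) (Y *m b) = dot (S *m (Y *m b)) (X *m a).
  by rewrite dotC (dotC _ (X *m a)) !dot_gram dotC (dotC (Y *m b)).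
move: (dot (T *m e) _) (dot e e) => te ee.
rewrite /c /e !(mulmxBl, mulmxBr, dotDl, dotDr, dotNl, dotNr).
rewrite (dot_mul X a b) (effect_sym eX) (dotC (X *m a) b).
lra.
Qed.

Lemma effect_aut0 T : effect_aut T 0 = 0.
Proof. by rewrite /effect_aut mulmx0 mul0mx. Qed.

Lemma effect_aut1 T : T \in unitmx -> effect_aut T 1%:M = 1%:M.
Proof.
move=> uT; rewrite /effect_aut mul1mx subrK mulmx1.
have uT' : T^T \in unitmx by rewrite unitmx_tr.
rewrite -{1}(mulKmx uT' T) mulmxK; first exact: mulVmx.
by rewrite unitmx_mul uT' uT.
Qed.

Lemma effect_aut_effect T X : T \in unitmx -> effect X -> effect (effect_aut T X).
Proof.
move=> uT eX; split.
  have := effect_aut_homo uT effect0 eX.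
  by rewrite effect_aut0 /loewner_le !subr0; apply; case: eX.
by rewrite -(effect_aut1 uT); apply: effect_aut_homo effect1 _ => //; case: eX.
Qed.

(** If U is the matrix inverted in [effect_aut T X], the one inverted in the second application is
    [T U^-1 T^-1], and the outer factors cancel. *)
Lemma effect_autK T X : T \in unitmx -> effect X ->
  effect_aut (invmx T) (effect_aut T X) = X.
Proof.
move=> uT eX; have uU := effect_aut_unit uT eX; rewrite /effect_aut.
set U := X *m _ + _ in uU *; set V := invmx T.
have uV : V \in unitmx by rewrite unitmx_inv.
set W := T *m invmx U *m X *m T^T.
have TV : T^T *m V^T = 1%:M by rewrite -trmx_mul mulVmx // trmx1.
have UV : U *m V = X *m T^T - X *m V + V.
  by rewrite mulmxDl mul1mx mulmxBr mulmx1 mulmxBl mulmxA mulmxK.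
set P := T *m invmx U in W *.
have -> : W *m (V^T *m V - 1%:M) + 1%:M = P *m V.
  have {2}-> : (1%:M : 'M[R]_n) = P *m (U *m V).
    by rewrite -mulmxA mulKmx // mulmxV.
  have -> : W *m (V^T *m V - 1%:M) = P *m (X *m V - X *m T^T).
    rewrite mulmxBr mulmx1 mulmxBr mulmxA /W !mulmxA; congr (_ *m V - _).
    by rewrite -(mulmxA _ T^T) TV mulmx1.
  by rewrite -mulmxDr UV !addrA subrK subrr add0r.
have -> : invmx (P *m V) = T *m U *m V.
  have uPV : P *m V \in unitmx by rewrite !unitmx_mul uT uV unitmx_inv uU.
  apply: (can_inj (mulKmx uPV)); rewrite mulmxV //.
  by rewrite -!mulmxA (mulmxA V) mulVmx // mul1mx mulKmx // mulmxV.
rewrite -!mulmxA (mulmxA V T) mulVmx // mul1mx TV.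
by rewrite mulmx1 mulKmx // (mulmxA U) mulmxV // mul1mx.
Qed.

End Automorphism.

(** * Strength preserving maps of the cone *)

(** Enclosing [n s] between consecutive integers bounds [n |g s - g 1 * s|] by [g 1] for every n;
    the Archimedean property concludes. *)
Lemma additive_monotone_linear (R : realType) (g : R -> R) :
  (forall s t, 0 <= s -> s <= t -> g s <= g t) ->
  (forall s t, 0 <= s -> 0 <= t -> g (s + t) = g s + g t) ->
  forall s, 0 <= s -> g s = g 1 * s.
Proof.
move=> gmono gadd.
have g0 : g 0 = 0 by have := gadd 0 0 (lexx _) (lexx _); rewrite addr0; lra.
have gn n s : 0 <= s -> g (n%:R * s) = n%:R * g s.
  move=> s0; elim: n => [|n IH]; first by rewrite !mul0r.
  by rewrite -natr1 !mulrDl !mul1r gadd ?mulr_ge0 // IH.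
have g1 : 0 <= g 1 by rewrite -g0 gmono.
move=> s s0; apply/eqP; rewrite -subr_eq0; apply/eqP; set d := _ - _.
have dn n : `|n%:R * d| <= g 1.
  have ns0 : 0 <= n%:R * s by rewrite mulr_ge0.
  have /andP[lo hi] := truncn_itv ns0; set m := Num.truncn _ in lo hi.
  have m0 : (0 : R) <= m%:R by exact: ler0n.
  have /(gmono _ _ m0) := lo; have := gmono _ _ ns0 (ltW hi).
  rewrite gn // -[m%:R]mulr1 -[m.+1%:R]mulr1 !gn // -natr1 => h1 h2.
  by rewrite ler_norml /d; apply/andP; split; nra.
apply/eqP; rewrite -normr_le0 leNgt; apply/negP => dp.
have := dn (Num.truncn (g 1 / `|d|)).+1.
have := truncnS_gt (g 1 / `|d|); rewrite ltr_pdivrMr // normrM normr_nat.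
by move=> h; rewrite leNgt h.
Qed.

(** Jensen at 0 gives [g (2 s) = 2 g s]; applied to the midpoint of s and t, this turns Jensen's
    equation into additivity. *)
Lemma jensen_monotone_linear (R : realType) (g : R -> R) :
  (forall s t, 0 <= s -> s <= t -> g s <= g t) -> g 0 = 0 ->
  (forall s d, 0 <= s -> 0 <= d -> g s + g (s + d + d) = 2 * g (s + d)) ->
  forall s, 0 <= s -> g s = g 1 * s.
Proof.
move=> gmono g0 gmid; apply: additive_monotone_linear => //.
have dbl s : 0 <= s -> g (s + s) = 2 * g s.
  by move=> s0; have := gmid 0 s (lexx _) s0; rewrite add0r g0 add0r.
have le_add s t : 0 <= s -> s <= t -> g (s + t) = g s + g t.
  move=> s0 st; have h0 : 0 <= (t - s) / 2 by lra.
  have := gmid s _ s0 h0; have -> : s + (t - s) / 2 + (t - s) / 2 = t by field.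
  rewrite -dbl; last by lra.
  by have -> : s + (t - s) / 2 + (s + (t - s) / 2) = s + t by field.
move=> s t s0 t0; have [st|/ltW ts] := leP s t; first exact: le_add.
by rewrite addrC le_add // addrC.
Qed.

(** * Vectors, symmetric matrices and binary quadratic forms in the plane *)

Section Plane.
Context {R : realType}.
Implicit Types (u v w : 'cV[R]_2) (A r C : 'M[R]_2).

Definition vec2 (a b : R) : 'cV[R]_2 := \col_i (if i == 0 then a else b).
Definition sym2 (a b c : R) : 'M[R]_2 :=
  \matrix_(i, j) (if i == j then if i == 0 then a else c else b).

Definition perp v : 'cV[R]_2 := vec2 (- v 1 0) (v 0 0).

Definition wedge u v : R := u 0 0 * v 1 0 - u 1 0 * v 0 0.

Lemma sum2 (F : 'I_2 -> R) : \sum_i F i = F 0 + F 1.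
Proof. by rewrite big_ord_recl big_ord1; congr (_ + F _); apply: val_inj. Qed.

Lemma ord2P (i : 'I_2) : i = 0 \/ i = 1.
Proof.
by case: (unliftP 0 i) => [k ->|->]; [right; rewrite ord1; exact: val_inj|left].
Qed.

Lemma eq_vec2 u v : u 0 0 = v 0 0 -> u 1 0 = v 1 0 -> u = v.
Proof.
by move=> h0 h1; apply/matrixP => i j; rewrite ord1; have [->|->] := ord2P i.
Qed.

Lemma vec2_neq0 a b : (vec2 a b != 0) = (a != 0) || (b != 0).
Proof.
rewrite -negb_and; congr negb; apply/eqP/andP => [h|[/eqP-> /eqP->]].
  by split; apply/eqP; [have /matrixP/(_ 0 0) := h|have /matrixP/(_ 1 0) := h];
    rewrite !mxE.
by apply: eq_vec2; rewrite !mxE.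
Qed.

Lemma dot_mul2 A u v : dot u (A *m v) =
  u 0 0 * A 0 0 * v 0 0 + u 0 0 * A 0 1 * v 1 0
  + u 1 0 * A 1 0 * v 0 0 + u 1 0 * A 1 1 * v 1 0.
Proof. by rewrite dotE sum2 !mxE !sum2; ring. Qed.

Lemma dot2 u v : dot u v = u 0 0 * v 0 0 + u 1 0 * v 1 0.
Proof. by rewrite dotE sum2. Qed.

Lemma sym2_tr a b c : (sym2 a b c)^T = sym2 a b c.
Proof. by apply/matrixP => i j; rewrite !mxE eq_sym; case: eqP => [->|]. Qed.

Lemma psd_sym2 a b c : 0 <= a -> 0 <= c -> b ^+ 2 <= a * c -> psdmx (sym2 a b c).
Proof.
move=> a0 c0 bac; apply/psdP; split=> [|v]; first exact: sym2_tr.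
rewrite dot_mul2 !mxE /=; move: (v 0 0) (v 1 0) => x y.
have [a00|ap] := eqVneq a 0.
  have -> : b = 0 by move: bac; rewrite a00 mul0r => h; nra.
  by rewrite a00; nra.
have : 0 <= a * (x * a * x + x * b * y + y * b * x + y * c * y).
  have -> : a * (x * a * x + x * b * y + y * b * x + y * c * y)
    = (a * x + b * y) ^+ 2 + (a * c - b ^+ 2) * y ^+ 2 by ring.
  by rewrite addr_ge0 ?sqr_ge0 // mulr_ge0 ?sqr_ge0 // subr_ge0.
by rewrite pmulr_rge0 // lt0r ap.
Qed.

Lemma wedge_eq0 u v : u != 0 -> wedge u v = 0 -> exists k, v = k *: u.
Proof.
move=> u0 uv; have := dot_gt0 u0; rewrite dot2 => d0; exists (dot u v / dot u u).
rewrite !dot2; move: uv; rewrite /wedge => uv.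
by apply: eq_vec2; rewrite !mxE; apply: (mulIf (lt0r_neq0 d0));
  rewrite mulrAC divfK ?lt0r_neq0 //;
  [move: (congr1 ( *%R (u 1 0)) uv)|move: (congr1 ( *%R (u 0 0)) uv)]; lra.
Qed.

Lemma sym_three_roots A u v w : A^T = A ->
  wedge u v != 0 -> wedge v w != 0 -> wedge u w != 0 ->
  dot u (A *m u) = 0 -> dot v (A *m v) = 0 -> dot w (A *m w) = 0 ->
  forall x, dot x (A *m x) = 0.
Proof.
move=> sA uv vw uw; have A10 : A 1 0 = A 0 1 by rewrite -[in LHS]sA mxE.
rewrite !dot_mul2 A10 => qu qv qw x; rewrite dot_mul2 A10.
have d0 : wedge u v * wedge v w * wedge u w != 0 by rewrite !mulf_neq0.
apply: (mulfI d0); rewrite mulr0.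
(* Lagrange interpolation of a binary quadratic form at three points *)
transitivity (0 * (wedge x v * wedge x w * wedge v w)
  - 0 * (wedge x u * wedge x w * wedge u w)
  + 0 * (wedge x u * wedge x v * wedge u v)); last by rewrite !mul0r subr0 addr0.
by rewrite -{1}qu -{1}qv -{1}qw /wedge; ring.
Qed.

(* For invertible A, the largest t with t vv^t <= A is 1 / <v, A^-1 v>; the
   relation says that K transports the order of these numbers from v to w. *)
Definition strength_map (K : 'M[R]_2 -> 'M[R]_2) v w := forall r s,
  psdmx r -> psdmx s ->
  (dot v (r *m v) <= dot v (s *m v)) <-> (dot w (K r *m w) <= dot w (K s *m w)).

(** The properties of [inverse_conj F] that force a congruence. The direction w depends on v alone,
    not on the matrices compared. *)
Definition cone_map (K : 'M[R]_2 -> 'M[R]_2) := [/\ K 0 = 0,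
  forall r, psdmx r -> psdmx (K r) &
  forall v, v != 0 -> exists2 w, w != 0 & strength_map K v w].

Lemma strength_map_eq K v w r s : psdmx r -> psdmx s -> strength_map K v w ->
  dot v (r *m v) = dot v (s *m v) -> dot w (K r *m w) = dot w (K s *m w).
Proof.
move=> pr ps Kvw e; apply/eqP; rewrite eq_le.
by apply/andP; split; apply/Kvw => //; rewrite e.
Qed.

(** The rank one matrix built on [perp v1] has the strength of 0 at v1 but not at v2. Were w2 a
    multiple of w1, its image could not tell the two directions apart. *)
Lemma strength_map_wedge K v1 v2 w1 w2 : K 0 = 0 -> w1 != 0 ->
  strength_map K v1 w1 -> strength_map K v2 w2 ->
  wedge v1 v2 != 0 -> wedge w1 w2 != 0.
Proof.
move=> K0 w10 K1 K2 v12; apply/eqP => /(wedge_eq0 w10) [k wk].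
pose p := perp v1.
have pp := psd_outer p.
have [+ _] := K1 _ _ pp psd0; have [_ +] := K2 _ _ pp psd0.
rewrite K0 wk !mul0mx !dot0r -scalemxAr dotZr dotZl => h2 h1.
have e1 : dot v1 (p *m p^T *m v1) = 0.
  by rewrite outerE dotZr dot2 !mxE /=; ring.
have e2 : dot v2 (p *m p^T *m v2) = wedge v1 v2 ^+ 2.
  by rewrite outerE dotZr !dot2 !mxE /= /wedge; ring.
move: h1 h2; rewrite e1 e2 => /(_ (lexx _)) h1 h2.
have : 0 < wedge v1 v2 ^+ 2 by rewrite exprn_even_gt0.
by rewrite ltNge h2 // mulrA -expr2 mulr_ge0_le0 ?sqr_ge0.
Qed.

(** The direction attached to v is the one K attaches to [C^-1 v]. This reduces an arbitrary
    direction to the first coordinate vector. *)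
Lemma cone_map_congr K C : C \in unitmx -> cone_map K ->
  cone_map (fun r => K (C^T *m r *m C)).
Proof.
move=> uC [K0 Kpsd Ksm]; have psdC r : psdmx r -> psdmx (C^T *m r *m C).
  by move=> pr; have := psd_congr C^T pr; rewrite trmxK.
split=> [|r /psdC/Kpsd //|v v0]; first by rewrite mulmx0 mul0mx.
have [|w w0 Kw] := Ksm (invmx C *m v).
  by apply: contra v0 => /eqP h; rewrite -(mulKVmx uC v) h mulmx0.
exists w => // r s pr ps; have := Kw _ _ (psdC r pr) (psdC s ps).
by rewrite -!mulmxA !(mulKVmx uC) !dot_mul !trmxK !(mulKVmx uC).
Qed.

Lemma cone_map_jensen K w s d : cone_map K -> w != 0 ->
  strength_map K (vec2 1 0) w -> 0 <= s -> 0 <= d ->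
  dot w (K (sym2 s 0 0) *m w) + dot w (K (sym2 (s + d + d) 0 0) *m w)
  = 2 * dot w (K (sym2 (s + d) 0 0) *m w).
Proof.
move=> [K0 Kpsd Ksm] w0 Kw s0 d0.
have wE a b a' b' : wedge (vec2 a b) (vec2 a' b') = a * b' - b * a'.
  by rewrite /wedge !mxE.
have [|w1 w10 K1] := Ksm (vec2 1 (-1)); first by rewrite vec2_neq0 oner_eq0.
have [|w2 w20 K2] := Ksm (vec2 1 1); first by rewrite vec2_neq0 oner_eq0.
have [|w3 w30 K3] := Ksm (vec2 0 1); first by rewrite vec2_neq0 oner_eq0 orbT.
(* [r10 - r00] and [r11 - r01] are proportional to x(x + y), and [r01 - r00]
   and [r11 - r10] to x(x - y), so the second difference of the four images
   vanishes at three directions, hence identically. *)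
pose r00 := sym2 s 0 d; pose r11 := sym2 (s + d + d) 0 d.
pose r10 := sym2 (s + d) (d / 2) d; pose r01 := sym2 (s + d) (- (d / 2)) d.
have p00 : psdmx r00 by apply: psd_sym2 => //; nra.
have p11 : psdmx r11 by apply: psd_sym2 => //; nra.
(* The lower right entry d leaves room for the off-diagonal one: [(d / 2)^2 <= (s + d) d]. *)
have p10 : psdmx r10 by apply: psd_sym2 => //; nra.
have p01 : psdmx r01 by apply: psd_sym2 => //; nra.
have ps t : 0 <= t -> psdmx (sym2 t 0 0) by move=> t0; apply: psd_sym2 => //; nra.
pose D := K r00 + K r11 - K r10 - K r01.
have DE x : dot x (D *m x) = dot x (K r00 *m x) + dot x (K r11 *m x)
    - dot x (K r10 *m x) - dot x (K r01 *m x).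
  by rewrite !mulmxBl mulmxDl !dotDr !dotNr.
have DT : D^T = D.
  by rewrite !linearB linearD /= !(psd_sym (Kpsd _ _)).
have eqK v u r r' : strength_map K v u -> psdmx r -> psdmx r' ->
    dot v (r *m v) = dot v (r' *m v) -> dot u (K r *m u) = dot u (K r' *m u).
  by move=> Kvu pr pr'; apply: strength_map_eq.
have D1 : dot w1 (D *m w1) = 0.
  rewrite DE (eqK _ _ r10 r00 K1) ?(eqK _ _ r01 r11 K1) //; first by ring.
  - by rewrite !dot_mul2 !mxE /=; field.
  - by rewrite !dot_mul2 !mxE /=; field.
have D2 : dot w2 (D *m w2) = 0.
  rewrite DE (eqK _ _ r10 r11 K2) ?(eqK _ _ r01 r00 K2) //; first by ring.
  - by rewrite !dot_mul2 !mxE /=; field.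
  - by rewrite !dot_mul2 !mxE /=; field.
have D3 : dot w3 (D *m w3) = 0.
  rewrite DE (eqK _ _ r10 r00 K3) ?(eqK _ _ r01 r11 K3) //; first by ring.
  - by rewrite !dot_mul2 !mxE /=; field.
  - by rewrite !dot_mul2 !mxE /=; field.
have w12 : wedge w1 w2 != 0.
  by apply: strength_map_wedge K0 w10 K1 K2 _; rewrite wE; lra.
have w23 : wedge w2 w3 != 0.
  by apply: strength_map_wedge K0 w20 K2 K3 _; rewrite wE; lra.
have w13 : wedge w1 w3 != 0.
  by apply: strength_map_wedge K0 w10 K1 K3 _; rewrite wE; lra.
(* At [vec2 1 0] only upper left entries count, so the vanishing of D at w is Jensen's equation. *)
have := sym_three_roots DT w12 w23 w13 D1 D2 D3 w; rewrite DE.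
rewrite (eqK _ _ r00 (sym2 s 0 0) Kw) ?(eqK _ _ r11 (sym2 (s + d + d) 0 0) Kw)
  ?(eqK _ _ r10 (sym2 (s + d) 0 0) Kw) ?(eqK _ _ r01 (sym2 (s + d) 0 0) Kw) //;
  try (by apply: ps; lra); try by rewrite !dot_mul2 !mxE /=; field.
lra.
Qed.

(** Jensen's equation makes g linear, strict monotonicity makes [g 1] positive, and dividing w by
    the square root of [g 1] normalises the slope. *)
Lemma cone_map_scale1 K : cone_map K -> exists2 w, w != 0 &
  forall r, psdmx r -> dot w (K r *m w) = r 0 0.
Proof.
move=> cK; have [K0 Kpsd Ksm] := cK.
have [|w w0 Kw] := Ksm (vec2 1 0).
  by rewrite vec2_neq0 oner_eq0.
pose g s := dot w (K (sym2 s 0 0) *m w).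
have ps t : 0 <= t -> psdmx (sym2 t 0 0) by move=> t0; apply: psd_sym2 => //; nra.
have r00E r : dot (vec2 1 0) (r *m vec2 1 0) = r 0 0.
  by rewrite dot_mul2 !mxE /=; ring.
have symE t : (sym2 t 0 0) 0 0 = t by rewrite mxE.
have gmono s t : 0 <= s -> 0 <= t -> s <= t <-> g s <= g t.
  by move=> s0 t0; have := Kw _ _ (ps s s0) (ps t t0); rewrite !r00E !symE.
have g0 : g 0 = 0.
  rewrite /g; have -> : sym2 0 0 0 = 0.
    by apply/matrixP => i j; rewrite !mxE; case: (i == j); case: (i == 0).
  by rewrite K0 mul0mx dot0r.
have glin s : 0 <= s -> g s = g 1 * s.
  apply: jensen_monotone_linear => //.
    by move=> a b a0 ab; apply/(gmono _ _ a0 (le_trans a0 ab)).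
  by move=> a d a0 d0; apply: cone_map_jensen.
have g1 : 0 < g 1.
  by rewrite ltNge -g0; apply/negP => /(gmono 1 0 ler01 (lexx _)).2; rewrite ler10.
exists ((Num.sqrt (g 1))^-1 *: w).
  by rewrite scaler_eq0 negb_or w0 andbT invr_eq0 sqrtr_eq0 -ltNge.
move=> r pr; rewrite -scalemxAr dotZr dotZl mulrA -expr2 exprVn sqr_sqrtr ?ltW //.
have r0 : 0 <= r 0 0 by rewrite -r00E; exact: psd_ge0.
have -> : dot w (K r *m w) = g (r 0 0).
  by apply: strength_map_eq Kw _ => //; [exact: ps|rewrite !r00E symE].
by rewrite (glin _ r0) mulKf // lt0r_neq0.
Qed.

Lemma det22 A : \det A = A 0 0 * A 1 1 - A 0 1 * A 1 0.
Proof.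
rewrite (expand_det_row _ 0) sum2 /cofactor !det_mx11 !mxE /= expr0 expr1.
have -> : lift 0 0 = 1 :> 'I_2 by exact: val_inj.
have -> : lift 1 0 = 0 :> 'I_2 by exact: val_inj.
by ring.
Qed.

Definition cols2 u v : 'M[R]_2 := \matrix_(i, j) (if j == 0 then u i 0 else v i 0).

Lemma cols2_unit u v : (cols2 u v \in unitmx) = (wedge u v != 0).
Proof. by rewrite unitmxE det22 !mxE /= unitfE /wedge (mulrC (v 0 0)). Qed.

(** Change of basis to v and [perp v]: the upper left entry of [B^T r B] is [<v, r v>]. *)
Lemma cone_map_scale K v : cone_map K -> v != 0 -> exists2 w, w != 0 &
  forall r, psdmx r -> dot w (K r *m w) = dot v (r *m v).
Proof.
move=> cK v0; pose B := cols2 v (perp v).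
have uB : B \in unitmx.
  rewrite cols2_unit; have := dot_gt0 v0; rewrite dot2 /wedge !mxE /= mulrN opprK.
  exact: lt0r_neq0.
have uC : invmx B \in unitmx by rewrite unitmx_inv.
have [w w0 Kw] := cone_map_scale1 (cone_map_congr uC cK).
exists w => // r pr.
have := Kw (B^T *m r *m B); rewrite -!mulmxA mulmxV // mulmx1.
rewrite (mulmxA (invmx B)^T) -trmx_mul mulmxV // trmx1 mul1mx => ->.
  rewrite mulmxA dot_mul2 !mxE !sum2 !mxE !sum2 !mxE /=; ring.
by have := psd_congr B^T pr; rewrite trmxK mulmxA.
Qed.

(** In the basis of the images w1, w2 of the coordinate directions, K becomes N, which keeps
    diagonals. The image of [vec2 1 1] has coordinates x, y equal to 1 or -1, so the off-diagonal
    entry is multiplied by the sign [x y]. *)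
Lemma cone_map_congruence K : cone_map K ->
  exists2 S, S \in unitmx & forall r, psdmx r -> K r = S *m r *m S^T.
Proof.
move=> cK; have [_ Kpsd _] := cK.
have [|w1 w10 K1] := cone_map_scale cK (_ : vec2 1 0 != 0).
  by rewrite vec2_neq0 oner_eq0.
have [|w2 w20 K2] := cone_map_scale cK (_ : vec2 0 1 != 0).
  by rewrite vec2_neq0 oner_eq0 orbT.
have [|w3 w30 K3] := cone_map_scale cK (_ : vec2 1 1 != 0).
  by rewrite vec2_neq0 oner_eq0.
have p11 : psdmx (sym2 1 0 0) by apply: psd_sym2 => //; nra.
have p22 : psdmx (sym2 0 0 1) by apply: psd_sym2 => //; nra.
pose W := cols2 w1 w2.
have uW : W \in unitmx.
  rewrite cols2_unit; apply/eqP => /(wedge_eq0 w10) [k wk].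
  have := K2 _ p22; rewrite wk -scalemxAr dotZr dotZl (K1 _ p22).
  by rewrite !dot_mul2 !mxE /=; lra.
pose N r := W^T *m K r *m W.
have NE r x y : dot x (N r *m y) = dot (W *m x) (K r *m (W *m y)).
  by rewrite /N -!mulmxA dot_mul trmxK.
have W1 : W *m vec2 1 0 = w1 by apply: eq_vec2; rewrite !mxE sum2 !mxE /=; ring.
have W2 : W *m vec2 0 1 = w2 by apply: eq_vec2; rewrite !mxE sum2 !mxE /=; ring.
have pN r : psdmx r -> psdmx (N r).
  by move=> /Kpsd pr; have := psd_congr W^T pr; rewrite trmxK.
have NK r : K r = invmx W^T *m N r *m invmx W.
  by rewrite /N -!mulmxA mulmxV // mulmx1 mulKmx // unitmx_tr.
clearbody N.
have N00 r : psdmx r -> N r 0 0 = r 0 0.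
  move=> pr; have := K1 r pr; rewrite -W1 -NE !dot_mul2 !mxE /=; lra.
have N11 r : psdmx r -> N r 1 1 = r 1 1.
  move=> pr; have := K2 r pr; rewrite -W2 -NE !dot_mul2 !mxE /=; lra.
have N10 r : psdmx r -> N r 1 0 = N r 0 1.
  by move=> /pN/psd_sym e; rewrite -[in LHS]e mxE.
have [u uE] : exists u, W *m u = w3 by exists (invmx W *m w3); rewrite mulKVmx.
set x := u 0 0; set y := u 1 0.
have N3 r : psdmx r ->
    x ^+ 2 * r 0 0 + 2 * (x * y) * N r 0 1 + y ^+ 2 * r 1 1
    = r 0 0 + r 0 1 + r 1 0 + r 1 1.
  move=> pr; have := K3 r pr; rewrite -uE -NE !dot_mul2 !mxE /= -/x -/y.
  by rewrite N00 // N11 // N10 //; lra.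
have N01_0 r : psdmx r -> r 0 0 * r 1 1 = 0 -> N r 0 1 = 0.
  move=> pr r0; have := psd_cauchy (vec2 1 0) (vec2 0 1) (pN r pr).
  rewrite !dot_mul2 !mxE /= N00 // N11 // => h; apply/eqP.
  by rewrite -sqrf_eq0 eq_le sqr_ge0 andbT; lra.
(* [N3] is tested on the two diagonal matrix units, where Cauchy-Schwarz ([N01_0]) kills the mixed
   term. *)
have x2 : x ^+ 2 = 1.
  have := N3 _ p11; rewrite N01_0 //; last by rewrite !mxE /= mulr0.
  by rewrite !mxE /=; lra.
have y2 : y ^+ 2 = 1.
  have := N3 _ p22; rewrite N01_0 //; last by rewrite !mxE /= mul0r.
  by rewrite !mxE /=; lra.
have xy2 : (x * y) ^+ 2 = 1 by rewrite exprMn x2 y2 mul1r.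
pose D := sym2 1 0 (x * y).
have ND r : psdmx r -> N r = D *m r *m D.
  move=> pr; have r10 : r 1 0 = r 0 1 by rewrite -[in LHS](psd_sym pr) mxE.
  have N01 : N r 0 1 = x * y * r 0 1.
    have := N3 r pr; rewrite x2 y2 r10 => h.
    have : (x * y) * (x * y * N r 0 1) = x * y * r 0 1 by congr (_ * _); lra.
    by rewrite mulrA -expr2 xy2 mul1r.
  apply/matrixP => i j.
  by case: (ord2P i) (ord2P j) => -> [] ->; rewrite ?N10 // ?N00 // ?N11 // ?N01 //
    !mxE !sum2 !mxE !sum2 !mxE /= ?r10; move: (congr1 ( *%R^~ (r 1 1)) xy2) => /=; lra.
have uD : D \in unitmx.
  rewrite unitmxE det22 !mxE /= unitfE mul1r mul0r subr0.
  by rewrite -sqrf_eq0 xy2 oner_eq0.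
have uWT : invmx W^T \in unitmx by rewrite unitmx_inv unitmx_tr.
exists (invmx W^T *m D); first by rewrite unitmx_mul uWT.
by move=> r pr; rewrite NK ND // trmx_mul sym2_tr trmx_inv trmxK !mulmxA.
Qed.

End Plane.

(** * From order automorphisms to maps of the cone *)

Section RankOne.
Context {R : realType} {n : nat}.
Implicit Types (u v w x : 'cV[R]_n) (A B X Y : 'M[R]_n).

(** One direction tests the order at [A^-1 v]; the other is Cauchy-Schwarz for A between x and
    [A^-1 v]. *)
Lemma outer_leP A v t : psdmx A -> A \in unitmx -> 0 <= t ->
  (t *: (v *m v^T) <=L A) <-> t * dot v (invmx A *m v) <= 1.
Proof.
move=> pA uA t0; set q := dot v _.
have outE x : dot x (t *: (v *m v^T) *m x) = t * dot x v ^+ 2.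
  by rewrite -scalemxAl outerE !dotZr (dotC v).
have qE : q = dot (invmx A *m v) (A *m (invmx A *m v)) by rewrite mulKVmx // dotC.
have q0 : 0 <= q by rewrite qE psd_ge0.
split=> [/(le_dot (invmx A *m v))|tq].
  rewrite outE -qE (dotC _ v) -/q => h; rewrite leNgt; apply/negP; nra.
apply/leLP => [||x]; rewrite ?(psd_sym pA) //.
  by rewrite psd_sym //; apply: psdZ => //; exact: psd_outer.
rewrite outE; have := psd_cauchy x (invmx A *m v) pA.
rewrite -qE mulKVmx //; have := psd_ge0 x pA.
set a := dot x (A *m x); set p := dot x v => a0 h.
by apply: (@le_trans _ _ (t * (a * q))); nra.
Qed.

(** Y kills the orthogonal complement of v, so by symmetry its range is orthogonal to that
    complement. *)
Lemma psd_rank1 Y v : psdmx Y -> v != 0 ->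
  (forall u, dot u v = 0 -> dot u (Y *m u) = 0) ->
  exists2 t, 0 <= t & Y = t *: (v *m v^T).
Proof.
move=> pY v0 h; have d0 := dot_gt0 v0; have d0' := lt0r_neq0 d0.
have Yker u : dot u v = 0 -> Y *m u = 0 by move=> /h; exact: psd_ker.
have proj x : exists2 u, dot u v = 0 & x = (dot x v / dot v v) *: v + u.
  exists (x - (dot x v / dot v v) *: v); last by rewrite addrC subrK.
  by rewrite dotDl dotNl dotZl divfK // subrr.
have [z zv Yv] := proj (Y *m v).
have z0 : z = 0.
  apply/eqP; rewrite -dot_eq0; apply/eqP.
  have : dot z (Y *m v) = 0 by rewrite dot_mul (psd_sym pY) Yker // dot0l.
  by rewrite Yv dotDr dotZr zv mulr0 add0r.
rewrite z0 addr0 in Yv.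
exists (dot (Y *m v) v / dot v v ^+ 2).
  by rewrite dotC divr_ge0 ?sqr_ge0 // psd_ge0.
apply: eq_mulcV => x; have [u uv xE] := proj x.
rewrite -scalemxAl outerE scalerA (dotC v) [in LHS]xE mulmxDr (Yker u uv) addr0.
rewrite -scalemxAr [in LHS]Yv scalerA; congr (_ *: _).
by field.
Qed.

Lemma le_outer Y v c : psdmx Y -> v != 0 -> Y <=L c *: (v *m v^T) ->
  exists2 t, 0 <= t & Y = t *: (v *m v^T).
Proof.
move=> pY v0 h; apply: psd_rank1 => // u uv; apply/eqP; rewrite eq_le psd_ge0 // andbT.
have := le_dot u h; rewrite -scalemxAl outerE dotZr dotZr uv.
by rewrite !mulr0.
Qed.

Lemma outer_comparable v s t :
  s *: (v *m v^T) <=L t *: (v *m v^T) \/ t *: (v *m v^T) <=L s *: (v *m v^T).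
Proof.
rewrite /loewner_le -!scalerBl.
by have [st|/ltW ts] := leP s t; [left|right]; apply: psdZ (psd_outer v);
  rewrite subr_ge0.
Qed.

Lemma effect_le A B : psdmx A -> A <=L B -> effect B -> effect A.
Proof. by move=> pA AB [_ B1]; split=> //; exact: leL_trans B1. Qed.

Lemma unit_add1 A : psdmx A -> A + 1%:M \in unitmx.
Proof.
move=> pA; apply/psd_unitP => [|x /dot_gt0 x0]; first exact: psdD psd1.
by rewrite mulmxDl mul1mx dotDr; have := psd_ge0 x pA; lra.
Qed.

(** Substituting [y = B x], so that [x = A y + y], turns both bounds into sums of nonnegative
    terms. *)
Lemma effect_inv_add1 A : psdmx A -> effect (invmx (A + 1%:M)).
Proof.
move=> pA; have uA := unit_add1 pA; set B := invmx _.
have sB : B^T = B by rewrite trmx_inv linearD /= trmx1 (psd_sym pA).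
have xE x : x = A *m (B *m x) + B *m x.
  by rewrite -[X in _ + X]mul1mx -mulmxDl mulKVmx.
have dE x : dot x (B *m x) = dot (B *m x) (A *m (B *m x)) + dot (B *m x) (B *m x).
  by rewrite [in LHS](dotC x) -dotDr -xE.
split; first by apply/psdP; split=> // x; rewrite dE addr_ge0 ?dot_ge0 ?psd_ge0.
apply/leLP => [||x]; rewrite ?trmx1 // mul1mx [X in _ <= dot X X]xE dE.
move: (B *m x) => y; rewrite !(dotDl, dotDr) (dotC (A *m y) y).
by have := dot_ge0 (A *m y); have := psd_ge0 y pA; lra.
Qed.

(** Substituting [x = A y] gives [<y, A y> - |A y|^2]. *)
Lemma effect_inv_sub1 A : effect A -> A \in unitmx -> psdmx (invmx A - 1%:M).
Proof.
move=> eA uA; apply/psdP; split=> [|x].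
  by rewrite linearB /= trmx_inv trmx1 (effect_sym eA).
rewrite mulmxBl mul1mx dotDr dotNr -[X in dot X X](mulKVmx uA).
rewrite -[X in dot X _](mulKVmx uA) (dotC (A *m _)) subr_ge0.
exact: effect_sq.
Qed.

End RankOne.

Section EffectIso.
Context {R : realType} {n : nat}.
Implicit Types (F G : 'M[R]_n -> 'M[R]_n).

(** Total matrix functions, constrained on effects only, avoid subtypes; carrying the inverse G
    makes the notion symmetric, so each lemma also applies to G. *)
Definition effect_iso F G := [/\ forall X, effect X -> effect (F X),
  forall X, effect X -> effect (G X),
  forall X, effect X -> G (F X) = X, forall X, effect X -> F (G X) = X &
  forall X Y, effect X -> effect Y -> X <=L Y <-> F X <=L F Y].

Lemma effect_iso_sym F G : effect_iso F G -> effect_iso G F.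
Proof.
move=> [eF eG GF FG leF]; split=> // X Y eX eY.
by have [h k] := leF _ _ (eG X eX) (eG Y eY); move: h k; rewrite !FG.
Qed.

Lemma effect_iso0 F G : effect_iso F G -> F 0 = 0.
Proof.
move=> [eF eG GF FG leF]; have e0 : effect (0 : 'M[R]_n) by exact: effect0.
have ge0 X : effect X -> 0 <=L X by case; rewrite /loewner_le subr0.
apply: leL_anti; last exact/ge0/eF.
by rewrite -[X in _ <=L X]FG //; apply/(leF _ _ e0 (eG _ e0))/ge0/eG.
Qed.

Lemma effect_iso1 F G : effect_iso F G -> F 1%:M = 1%:M.
Proof.
move=> [eF eG GF FG leF]; have e1 : effect (1%:M : 'M[R]_n) by exact: effect1.
apply: leL_anti; first by case: (eF _ e1).
by rewrite -[X in X <=L _]FG //; apply/(leF _ _ (eG _ e1) e1); case: (eG _ e1).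
Qed.

End EffectIso.

Section PlaneEffects.
Context {R : realType}.
Implicit Types (v w : 'cV[R]_2) (A B X Y : 'M[R]_2) (F G K : 'M[R]_2 -> 'M[R]_2).

Lemma perp_eq0 v : (perp v == 0) = (v == 0).
Proof. by rewrite -!dot_eq0 !dot2 !mxE /= mulrNN addrC. Qed.

Lemma outer_singular v t : t *: (v *m v^T) \notin unitmx.
Proof.
rewrite unitmxE det22 !mxE !big_ord1 !mxE unitfE negbK; apply/eqP; ring.
Qed.

(** In the plane, the complement of [perp x] is the line of a kernel vector x, so X is a multiple of
    the projection onto [perp x]. *)
Lemma psd_singular X : psdmx X -> X \notin unitmx ->
  exists v t, [/\ v != 0, 0 <= t & X = t *: (v *m v^T)].
Proof.
move=> pX sX; have [x x0 Xx] : exists2 x : 'cV_2, x != 0 & X *m x = 0.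
  apply: contrapT => h; move: sX => /negP[]; apply/(psd_unitP pX) => x x0.
  rewrite lt0r psd_ge0 // andbT; apply/eqP => /(psd_ker pX) Xx.
  by apply: h; exists x.
have p0 : perp x != 0 by rewrite perp_eq0.
have [|t t0 XE] := psd_rank1 pX p0; last by exists (perp x), t.
move=> u; rewrite dotC => up; have [|k ->] := @wedge_eq0 _ x u x0.
  by move: up; rewrite dot2 !mxE /= /wedge; lra.
by rewrite -scalemxAr Xx scaler0 dot0r.
Qed.

(** Below a singular effect all effects are comparable, whereas an invertible X dominates positive
    multiples of both coordinate projections, which are incomparable. *)
Lemma effect_iso_unit F G X : effect_iso F G -> effect X -> X \in unitmx ->
  F X \in unitmx.
Proof.
move=> /effect_iso_sym [eG eF FG GF leG] eX uX; apply/negPn/negP => sFX.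
have eFX := eF X eX; have [v [c [v0 c0 FXE]]] := psd_singular (proj1 eFX) sFX.
have below (u : 'cV_2) : u != 0 -> exists2 t, 0 < t &
    effect (t *: (u *m u^T)) /\ exists s, F (t *: (u *m u^T)) = s *: (v *m v^T).
  move=> u0; have uXi : invmx X \in unitmx by rewrite unitmx_inv.
  have q0 : 0 < dot u (invmx X *m u).
    rewrite -[X in dot X _](mulKVmx uX) dotC; apply/psd_unitP => //.
      by case: eX.
    by apply: contra u0 => /eqP h; rewrite -(mulKVmx uX u) h mulmx0.
  have t0 : 0 < (dot u (invmx X *m u))^-1 by rewrite invr_gt0.
  exists (dot u (invmx X *m u))^-1 => //; set Y := _ *: _.
  have YX : Y <=L X.
    by apply/outer_leP; [case: eX| | exact: ltW| rewrite mulVf ?lt0r_neq0].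
  have eY : effect Y.
    by apply: effect_le YX eX; apply: psdZ (ltW t0) (psd_outer _).
  split=> //; have [|||s _ ->] := @le_outer _ _ (F Y) v c => //; last by exists s.
    by case: (eF Y eY).
  by rewrite -FXE; apply/(leG _ _ (eF _ eY) eFX); rewrite !GF.
have [|t1 t10 [e1 [s1 F1]]] := below (vec2 1 0); first by rewrite vec2_neq0 oner_eq0.
have [|t2 t20 [e2 [s2 F2]]] := below (vec2 0 1).
  by rewrite vec2_neq0 oner_eq0 orbT.
have h1 := leG _ _ (eF _ e1) (eF _ e2); have h2 := leG _ _ (eF _ e2) (eF _ e1).
rewrite !GF // F1 F2 in h1 h2.
have [/h1/(le_dot (vec2 1 0))|/h2/(le_dot (vec2 0 1))] := outer_comparable v s1 s2;
  by rewrite -!scalemxAl !outerE !(dotZr, dot2) !mxE /=; lra.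
Qed.

Lemma effect_iso_singular F G X : effect_iso F G -> effect X -> X \notin unitmx ->
  F X \notin unitmx.
Proof.
move=> FG eX; apply: contra => uFX; have [eF _ GF _ _] := FG.
by rewrite -(GF X eX); apply: effect_iso_unit (effect_iso_sym FG) _ uFX; exact: eF.
Qed.

(** Q is the largest multiple of [w w^T] below [F B]. Its preimage is a multiple of [v v^T] below B,
    hence below A by the hypothesis on strengths, so [Q <= F A]. *)
Lemma effect_iso_strength F G v w c d A B : effect_iso F G ->
  v != 0 -> w != 0 -> 0 < c -> 0 < d ->
  effect (c *: (v *m v^T)) -> F (c *: (v *m v^T)) = d *: (w *m w^T) ->
  effect A -> A \in unitmx -> effect B -> B \in unitmx ->
  dot v (invmx A *m v) <= dot v (invmx B *m v) ->
  dot w (invmx (F A) *m w) <= dot w (invmx (F B) *m w).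
Proof.
move=> FG v0 w0 c0 d0 eP FP eA uA eB uB AB.
have GF' := effect_iso_sym FG; have [eF eG GF FGK leF] := FG.
have [uFA uFB] := (effect_iso_unit FG eA uA, effect_iso_unit FG eB uB).
have [[pFA _] [pFB _]] := (eF _ eA, eF _ eB).
set k := dot w (invmx (F B) *m w).
have k0 : 0 < k.
  have p : psdmx (invmx (F B)).
    have := psdD (effect_inv_sub1 (eF _ eB) uFB) (@psd1 R 2).
    by rewrite subrK.
  by apply/psd_unitP => //; rewrite unitmx_inv.
pose Q := k^-1 *: (w *m w^T).
have QB : Q <=L F B.
  by apply/outer_leP => //; rewrite -/k ?mulVf ?lt0r_neq0 ?invr_ge0 // ltW.
have eQ : effect Q.
  by apply: effect_le QB (eF _ eB); apply: psdZ (psd_outer _); rewrite invr_ge0 ltW.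
have eGQ := eG _ eQ.
have [t t0 GQ] : exists2 t, 0 <= t & G Q = t *: (v *m v^T).
  have sGQ : G Q \notin unitmx.
    by apply: effect_iso_singular GF' eQ _; exact: outer_singular.
  (* Q is comparable with the image of [c v v^T]. If it is smaller, [G Q] lies below [c v v^T]; if
     larger, [G Q] is a rank one effect above it. Either way the direction is v. *)
  have [h|h] := outer_comparable w k^-1 d.
    apply: (@le_outer _ _ _ v c) => //; first by case: eGQ.
    by apply/(leF _ _ eGQ eP); rewrite FGK // FP.
  have [y [s [y0 s0 GQE]]] := psd_singular (proj1 eGQ) sGQ.
  have PG : c *: (v *m v^T) <=L s *: (y *m y^T).
    by rewrite -GQE; apply/(leF _ _ eP eGQ); rewrite FGK // FP.
  have [s' s'0 PE] := le_outer (proj1 eP) y0 PG.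
  have s'p : s' != 0.
    apply/eqP => s'00; have := congr1 (fun M => dot v (M *m v)) PE.
    rewrite s'00 scale0r mul0mx dot0r -scalemxAl outerE !dotZr.
    by apply/eqP; rewrite !mulf_neq0 ?dot_eq0 ?lt0r_neq0.
  exists (s / s' * c); first by rewrite mulr_ge0 ?divr_ge0 // ltW.
  by rewrite -scalerA PE scalerA divfK.
have GQA : G Q <=L A.
  rewrite GQ; apply/outer_leP => //; first by case: eA.
  apply: (@le_trans _ _ (t * dot v (invmx B *m v))); first exact: ler_wpM2l.
  apply/outer_leP => //; first by case: eB.
  by rewrite -GQ; apply/(leF _ _ eGQ eB); rewrite FGK.
have : Q <=L F A by rewrite -[Q]FGK //; apply/(leF _ _ eGQ eA).
move/outer_leP => /(_ pFA uFA); rewrite invr_ge0 ltW // => /(_ isT).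
by rewrite mulrC ler_pdivrMr // mul1r.
Qed.

(** F read in the coordinate [X^-1 - 1] of an invertible effect X. *)
Definition inverse_conj F A := invmx (F (invmx (A + 1%:M))) - 1%:M.

(** The direction w is that of the image of the projection onto v. The converse implication of
    [strength_map] is the direct one for G. *)
Lemma effect_iso_cone_map F G : effect_iso F G -> cone_map (inverse_conj F).
Proof.
move=> FG; have [eF eG GF FGK leF] := FG.
have uK A : psdmx A -> F (invmx (A + 1%:M)) \in unitmx.
  move=> pA; apply: effect_iso_unit FG (effect_inv_add1 pA) _.
  by rewrite unitmx_inv unit_add1.
split=> [|A pA|v v0].
- by rewrite /inverse_conj add0r invmx1 (effect_iso1 FG) invmx1 subrr.
- by apply: effect_inv_sub1 (uK A pA); apply/eF/effect_inv_add1.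
have vv0 := dot_gt0 v0; set c := (dot v v)^-1.
have c0 : 0 < c by rewrite invr_gt0.
have pP : psdmx (c *: (v *m v^T)) by apply: psdZ (ltW c0) (psd_outer v).
have eP : effect (c *: (v *m v^T)).
  apply: effect_le pP _ (@effect1 R 2).
  apply/outer_leP; rewrite ?unitmx1 ?(ltW c0) //; first exact: psd1.
  by rewrite invmx1 mul1mx mulVf ?lt0r_neq0.
have sFP := effect_iso_singular FG eP (outer_singular v c).
have [w [d [w0 d0 FP]]] := psd_singular (proj1 (eF _ eP)) sFP.
have dp : 0 < d.
  rewrite lt0r d0 andbT; apply/eqP => d00; move: FP; rewrite d00 scale0r.
  move=> /(congr1 G); rewrite GF // (effect_iso0 (effect_iso_sym FG)).
  move=> /(congr1 (fun M => dot v (M *m v))).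
  rewrite mul0mx dot0r -scalemxAl outerE !dotZr.
  by apply/eqP; rewrite !mulf_neq0 ?lt0r_neq0.
exists w => // r s pr ps.
have [ur us] := (unit_add1 pr, unit_add1 ps).
have [er es] := (effect_inv_add1 pr, effect_inv_add1 ps).
have iE A x : dot x (A *m x) = dot x ((A + 1%:M) *m x) - dot x x.
  by rewrite mulmxDl mul1mx dotDr addrK.
(* Adding the squared norm to both sides replaces each matrix by the inverse of an effect. *)
rewrite (iE r) (iE s) /inverse_conj (iE (_ - _)) (iE (invmx (F (invmx (s + _))) - _)).
rewrite !subrK !lerD2r -{1}(invmxK (r + _)) -{1}(invmxK (s + _)).
have [uir uis] : invmx (r + 1%:M) \in unitmx /\ invmx (s + 1%:M) \in unitmx.
  by rewrite !unitmx_inv.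
split; first exact: effect_iso_strength FG v0 w0 c0 dp eP FP er uir es uis.
have GFP : G (d *: (w *m w^T)) = c *: (v *m v^T) by rewrite -FP GF.
have ePF : effect (d *: (w *m w^T)) by rewrite -FP; exact: eF.
have := effect_iso_strength (effect_iso_sym FG) w0 v0 dp c0 ePF GFP
  (eF _ er) (uK r pr) (eF _ es) (uK s ps).
by rewrite !GF.
Qed.

Lemma effect_iso_aut F G : effect_iso F G ->
  exists2 T, T \in unitmx & forall X, effect X -> F X = effect_aut T X.
Proof.
move=> FG; have [eF eG GF FGK leF] := FG.
have [S uS FS] := cone_map_congruence (effect_iso_cone_map FG).
have uST : S^T \in unitmx by rewrite unitmx_tr.
pose T := invmx S^T; have uT : T \in unitmx by rewrite unitmx_inv.
have STT : S *m T^T = 1%:M by rewrite trmx_inv trmxK mulmxV.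
have FT X : effect X -> X \in unitmx -> F X = effect_aut T X.
  move=> eX uX; have := FS _ (effect_inv_sub1 eX uX).
  rewrite /inverse_conj subrK invmxK => /(canRL (addrNK _)) FXi.
  have uFX := effect_iso_unit FG eX uX; have uU := effect_aut_unit uT eX.
  rewrite -[F X]mulmx1; apply: (canLR (mulKVmx uFX)).
  rewrite FXi /effect_aut; set U := X *m _ + _ in uU *.
  (* As [S^T T = 1] and [T = S T^T T], the product of [(F X)^-1] and [T] is [S X^-1 U], which
     cancels the inverse of U. *)
  have XU : invmx X *m U = invmx X - 1%:M + T^T *m T.
    by rewrite mulmxDr mulKmx // mulmx1 addrC addrA addrAC.
  rewrite mulmxDl mul1mx !mulmxA -(mulmxA _ S^T) mulmxV // mulmx1.
  have {2}-> : T = S *m T^T *m T by rewrite STT mul1mx.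
  rewrite -(mulmxA S T^T) -!(mulmxA S) -!mulmxDr -!mulmxDl -XU.
  by rewrite -!mulmxA mulKVmx // mulKmx.
exists T => // X eX.
have uTi : invmx T \in unitmx by rewrite unitmx_inv.
(* For arbitrary X, Z is the preimage of [F X] under [effect_aut T]; X and Z have the same
   invertible upper bounds, hence coincide by [leL_approx]. *)
have eFX := eF _ eX; pose Z := effect_aut (invmx T) (F X).
have eZ : effect Z by exact: effect_aut_effect.
have TZ : effect_aut T Z = F X by have := effect_autK uTi eFX; rewrite invmxK.
have same Y : effect Y -> Y \in unitmx -> X <=L Y <-> Z <=L Y.
  move=> eY uY; rewrite (leF _ _ eX eY) (FT _ eY uY) -TZ; split.
    move=> /(effect_aut_homo uTi (effect_aut_effect uT eZ) (effect_aut_effect uT eY)).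
    by rewrite !effect_autK.
  exact: effect_aut_homo.
rewrite -TZ; congr effect_aut; apply: leL_anti.
  by apply: leL_approx => // Y eY uY; apply: (same Y eY uY).1.
by apply: leL_approx => // Y eY uY; apply: (same Y eY uY).2.
Qed.

End PlaneEffects.

Theorem theorem4p1 (R : realType)
    (phi : mx_interval (0 : 'M[R]_2) 1%:M -> mx_interval (0 : 'M[R]_2) 1%:M) :
  order_automorphism phi <->
  exists T : 'M[R]_2, T \in unitmx /\
    forall X : mx_interval (0 : 'M[R]_2) 1%:M,
      val (phi X) =
        T *m invmx (val X *m (T^T *m T - 1%:M) + 1%:M) *m val X *m T^T.
Proof.
have valP' (X : mx_interval (0 : 'M[R]_2) 1%:M) : effect (val X).
  by apply/effectP; exact: set_mem (valP X).
pose mk Y (eY : effect Y) : mx_interval (0 : 'M[R]_2) 1%:M :=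
  exist _ Y (mem_set ((effectP Y).2 eY)).
split=> [[[psi phiK psiK] le_phi]|[T [uT phiE]]].
  pose x0 := mk _ (@effect0 R 2).
  (* [insubd] sends every matrix that is not an effect to the zero effect, which extends [phi] and
     [psi] to all matrices. *)
  pose F X := val (phi (insubd x0 X)); pose G X := val (psi (insubd x0 X)).
  have insE X : effect X -> val (insubd x0 X) = X.
    by move=> eX; rewrite insubdK //; exact/mem_set/effectP.
  have FG : effect_iso F G.
    split=> [X _|X _|X eX|X eX|X Y eX eY]; rewrite /F /G ?valKd ?phiK ?psiK ?insE //.
    by have := le_phi (insubd x0 X) (insubd x0 Y); rewrite !insE.
  have [T uT FT] := effect_iso_aut FG; exists T; split=> // X.
  by rewrite -[RHS]/(effect_aut T (val X)) -FT // /F valKd.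
have uTi : invmx T \in unitmx by rewrite unitmx_inv.
have phiT X : val (phi X) = effect_aut T (val X) := phiE X.
split.
  exists (fun X => mk _ (effect_aut_effect uTi (valP' X))) => X; apply: val_inj => /=.
    by rewrite phiT effect_autK.
  by rewrite phiT /=; have := effect_autK uTi (valP' X); rewrite invmxK.
move=> X Y; rewrite !phiT; split; first exact: effect_aut_homo.
have eT Z := effect_aut_effect uT (valP' Z).
move=> /(effect_aut_homo uTi (eT X) (eT Y)).
by rewrite !effect_autK.
Qed.
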